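(* Let $M$ and $N$ be finite-dimensional complex vector spaces and let $\Omega$ be an open semialgebraic subset of $M$. If $\varphi:\Omega\to N$ is a holomorphic semialgebraic mapping, then $\varphi$ is a Nash mapping.
   Context: A subset of a finite-dimensional complex vector space is semialgebraic if, regarding the space as a real vector space, it is a finite union of sets of the form $\{x: f_1(x)=\dots=f_r(x)=0,\ g_1(x)>0,\dots,g_s(x)>0\}$ with $f_i,g_j$ real polynomial functions. A holomorphic semialgebraic mapping $\varphi:\Omega\to N$ is a holomorphic map whose graph is a semialgebraic subset of $M\times N$. A holomorphic function $f$ on $\Omega$ is a Nash function if for every $x_0\in\Omega$ there exist an open neighbourhood $U$ of $x_0$ in $\Omega$ and a nonzero complex polynomial function $P:M\times\mathbb{C}\to\mathbb{C}$ with $P(x,f(x))=0$ for all $x\in U$. A holomorphic mapping $\Omega\to N$ is a Nash mapping if its components with respect to some basis of $N$ are Nash functions. *)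

(* Defs.v *)
From HB Require Import structures.
From mathcomp Require Export all_boot all_order all_algebra.
From mathcomp Require Export complex.
From mathcomp Require Export boolp classical_sets reals topology normedtype derive.

Set Implicit Arguments.
Unset Strict Implicit.
Unset Printing Implicit Defensive.

Import Order.TTheory GRing.Theory Num.Theory.
Import numFieldNormedType.Exports.
Import passmx.

Local Open Scope classical_set_scope.
Local Open Scope complex_scope.
Local Open Scope ring_scope.

(* R[i] as a vector space and a normed space over itself, which numFieldNormedType
   provides only for abstract numeric fields. *)
HB.instance Definition _ (R : realType) := Vector.copy R[i] (R[i])^o.
HB.instance Definition _ (R : realType) := NormedModule.copy R[i] (R[i])^o.

(* The algebra of functions V -> K generated by the constants and a set L of
   linear functionals; when L is the whole dual of a finite-dimensional space V,
   these are the polynomial functions on V, without any choice of a basis. *)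
Inductive poly_fun (V : Type) (K : pzRingType) (L : set (V -> K)) :
    set (V -> K) :=
| PolyCst (c : K) : poly_fun L (fun=> c)
| PolyLin (l : V -> K) of L l : poly_fun L l
| PolyAdd (f g : V -> K) of poly_fun L f & poly_fun L g :
    poly_fun L (fun x => f x + g x)
| PolyMul (f g : V -> K) of poly_fun L f & poly_fun L g :
    poly_fun L (fun x => f x * g x).

Section VectorSpaces.
Variable R : realType.

Definition real_linear (V : vectType R[i]) (l : V -> R) : Prop :=
  forall (a : R) (u v : V), l (a%:C *: u + v) = a * l u + l v.

Definition real_poly_fun (V : vectType R[i]) : set (V -> R) :=
  poly_fun (@real_linear V).

Definition complex_poly_fun (V : vectType R[i]) : set (V -> R[i]) :=
  poly_fun [set l : V -> R[i] | scalar l].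

Definition basic_semialgebraic (V : vectType R[i]) (B : set V) : Prop :=
  exists (r s : nat) (f : 'I_r -> V -> R) (g : 'I_s -> V -> R),
    [/\ forall i, real_poly_fun (f i),
        forall j, real_poly_fun (g j) &
        B = [set x | (forall i, f i x = 0) /\ (forall j, 0 < g j x)]].

Definition semialgebraic (V : vectType R[i]) (A : set V) : Prop :=
  exists (k : nat) (B : 'I_k -> set V),
    (forall i, basic_semialgebraic (B i)) /\ A = \bigcup_i B i.

(* A vectType carries no topology, so openness and complex differentiability are
   read in the coordinates of the basis vbasis {:V}. Neither notion depends on
   the basis, since linear bijections of C^n are homeomorphisms. *)
Definition open_vect (V : vectType R[i]) (A : set V) : Prop :=
  open [set u : 'rV[R[i]]_(\dim {:V}) | A (vecof (vbasis {:V}) u)].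

(* Maps on Omega are encoded as total maps, whose values outside Omega are
   irrelevant when Omega is open. *)
Definition holomorphic (V W : vectType R[i]) (Omega : set V) (f : V -> W) :
    Prop :=
  forall x, Omega x ->
    differentiable
      (fun u : 'rV[R[i]]_(\dim {:V}) =>
         rVof (vbasis {:W}) (f (vecof (vbasis {:V}) u)))
      (rVof (vbasis {:V}) x).

Definition graph_on (V W : vectType R[i]) (Omega : set V) (f : V -> W) :
    set (V * W)%type :=
  [set p | Omega p.1 /\ p.2 = f p.1].

Definition holomorphic_semialgebraic (V W : vectType R[i]) (Omega : set V)
    (f : V -> W) : Prop :=
  holomorphic Omega f /\ semialgebraic (graph_on Omega f).

Definition nash_function (V : vectType R[i]) (Omega : set V)
    (f : V -> R[i]) : Prop :=
  holomorphic Omega f /\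
  forall x0, Omega x0 ->
    exists (U : set V) (P : V * R[i] -> R[i]),
      [/\ open_vect U, U x0 & U `<=` Omega] /\
      [/\ complex_poly_fun P, exists z, P z != 0 &
          forall x, U x -> P (x, f x) = 0].

Definition nash_mapping (V W : vectType R[i]) (Omega : set V) (f : V -> W) :
    Prop :=
  holomorphic Omega f /\
  exists b : (\dim {:W}).-tuple W,
    basis_of {:W} b /\
    forall i, nash_function Omega (fun x => coord b i (f x)).

End VectorSpaces.

(* Main.v *)
Require Import Defs.
From mathcomp Require Import all_boot all_order all_algebra complex.
From mathcomp Require Import classical_sets reals.
From mathcomp Require Import boolp functions topology normedtype derive.
From mathcomp Require Import zify ring ordered_qelim qe_rcf.

(* Let f be a coordinate of phi. The set of (x, s, t) with x in Omega, s real
   and t = Re f(x) + s Im f(x) is defined by a formula over the reals, hence by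
   a quantifier-free one; the product of its nonzero atoms vanishes on it, since
   elsewhere the truth value would be locally constant in t. This gives a
   nonzero real polynomial relation between Re x, Im x, s and
   Re f(x) + s Im f(x). For fixed x it is polynomial in s, so it persists for
   complex s; after division by a power of s - i, the value s = i yields a
   nonzero complex polynomial G with G(x, x^*, f(x)) = 0 on Omega. Finally, if
   sum_k (z^* )^k g_k(z) vanishes on an open set and the g_k are holomorphic,
   the Cauchy-Riemann operator shows that every g_k vanishes; so the conjugate
   variables can be removed from G one at a time. The relation obtained holds on
   all of Omega, so no identity theorem is needed. *)

Set Implicit Arguments.
Unset Strict Implicit.
Unset Printing Implicit Defensive.

Import Order.TTheory GRing.Theory Num.Theory.
Import numFieldNormedType.Exports.
Import passmx.

Local Open Scope classical_set_scope.
Local Open Scope complex_scope.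
Local Open Scope ring_scope.

(** * Polynomial functions in countably many variables *)

Section PolynomialFunctions.

Lemma poly_fun_comp (V W : Type) (K : pzRingType) (L : set (V -> K))
    (L' : set (W -> K)) (h : W -> V) (f : V -> K) :
  (forall l, L l -> poly_fun L' (l \o h)) -> poly_fun L f ->
  poly_fun L' (f \o h).
Proof.
move=> LL'; elim=> [c|l /LL'//|f1 f2 _ IH1 _ IH2|f1 f2 _ IH1 _ IH2].
- exact: PolyCst.
- exact: PolyAdd IH1 IH2.
- exact: PolyMul IH1 IH2.
Qed.

Variable K : numFieldType.
Implicit Types (D : set nat) (e : nat -> K) (F G : (nat -> K) -> K).

(* Environments are total maps on nat; D records the variables that may occur. *)
Definition coord_fun D : set ((nat -> K) -> K) :=
  [set l | exists2 i, D i & l = fun e => e i].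

Local Notation pf D := (poly_fun (coord_fun D)).

Definition upd e j (s : K) : nat -> K := fun i => if i == j then s else e i.

Lemma pf_var D i : D i -> pf D (fun e => e i).
Proof. by move=> Di; apply: PolyLin; exists i. Qed.

Lemma pf_sub D D' F : D `<=` D' -> pf D F -> pf D' F.
Proof.
move=> DD'; apply: (@poly_fun_comp _ _ _ _ _ id) => l [i /DD' Di ->].
exact: pf_var.
Qed.

Lemma pf_sum D (I : Type) (r : seq I) (F : I -> (nat -> K) -> K) :
  (forall i, pf D (F i)) -> pf D (fun e => \sum_(i <- r) F i e).
Proof.
move=> pfF; elim: r => [|i r IH].
  by under eq_fun do rewrite big_nil; exact: PolyCst.
by under eq_fun do rewrite big_cons; apply: PolyAdd.
Qed.

Lemma pf_exp D F n : pf D F -> pf D (fun e => F e ^+ n).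
Proof.
move=> pfF; elim: n => [|n IH].
  by under eq_fun do rewrite expr0; exact: PolyCst.
by under eq_fun do rewrite exprS; apply: PolyMul.
Qed.

Lemma pf_local D F e e' : pf D F -> {in D, e =1 e'} -> F e = F e'.
Proof.
move=> pfF ee'; elim: pfF => //= [l [i Di ->]|f g _ -> _ ->|f g _ -> _ ->] //.
by apply: ee'; rewrite inE.
Qed.

(** Formulas are evaluated on finite lists padded with zeros; this bound tells how long a list must
    be for [F] not to notice that an environment was truncated. *)
Lemma pf_finite D F : pf D F -> exists N, pf (D `&` `I_N) F.
Proof.
elim=> [c|l [i Di ->]|f g _ [N1 IH1] _ [N2 IH2]|f g _ [N1 IH1] _ [N2 IH2]].
- by exists 0%N; exact: PolyCst.
- by exists i.+1; apply: pf_var; split=> /=.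
- exists (maxn N1 N2); apply: PolyAdd.
  + by apply: pf_sub IH1 => i [Di /= iN]; split=> //=; rewrite leq_max iN.
  + by apply: pf_sub IH2 => i [Di /= iN]; split=> //=; rewrite leq_max iN orbT.
- exists (maxn N1 N2); apply: PolyMul.
  + by apply: pf_sub IH1 => i [Di /= iN]; split=> //=; rewrite leq_max iN.
  + by apply: pf_sub IH2 => i [Di /= iN]; split=> //=; rewrite leq_max iN orbT.
Qed.

Lemma pf_line D F e d : pf D F ->
  exists p : {poly K}, forall s, F (fun i => e i + s * d i) = p.[s].
Proof.
elim=> [c|l [i _ ->]|f g _ [p IH1] _ [q IH2]|f g _ [p IH1] _ [q IH2]].
- by exists c%:P => s; rewrite hornerC.
- by exists ((e i)%:P + 'X * (d i)%:P) => s; rewrite !hornerE.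
- by exists (p + q) => s; rewrite IH1 IH2 hornerD.
- by exists (p * q) => s; rewrite IH1 IH2 hornerM.
Qed.

Lemma pf_upd_line D F e j : pf D F ->
  exists p : {poly K}, forall s, F (upd e j s) = p.[s].
Proof.
move=> /(pf_line (upd e j 0) (upd (fun=> 0) j 1))[p Fp]; exists p => s.
rewrite -Fp; congr F; apply/funext => i; rewrite /upd.
by case: eqP => _; ring.
Qed.

Lemma poly_zeros_eq0 (p : {poly K}) : (forall n : nat, p.[n%:R] = 0) -> p = 0.
Proof.
move=> p0; apply: (@roots_geq_poly_eq0 _ _ [seq n%:R | n <- iota 0 (size p)]).
- by apply/allP => _ /mapP[n _ ->]; apply/rootP.
- rewrite map_inj_uniq ?iota_uniq // => m n /eqP.
  by rewrite eqr_nat => /eqP.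
- by rewrite size_map size_iota.
Qed.

(** On the line through a point where [F] is nonzero and a point where [G] is nonzero, both restrict
    to nonzero univariate polynomials, and [{poly K}] is an integral domain. *)
Lemma pf_mul_neq0 D F G : pf D F -> pf D G -> (exists e, F e != 0) ->
  (exists e, G e != 0) -> exists e, F e * G e != 0.
Proof.
move=> pfF pfG [a Fa] [b Gb].
have [p Fp] := pf_line a (fun i => b i - a i) pfF.
have [q Gq] := pf_line a (fun i => b i - a i) pfG.
have p0 : p != 0.
  apply: contra_neq Fa => p0; have := Fp 0; rewrite p0 horner0 => <-.
  by congr F; apply/funext => i; ring.
have q0 : q != 0.
  apply: contra_neq Gb => q0; have := Gq 1; rewrite q0 horner0 => <-.
  by congr G; apply/funext => i; ring.
apply/not_existsP => FG0.
have : p * q = 0.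
  apply: poly_zeros_eq0 => n; rewrite hornerM -Fp -Gq.
  by apply/eqP/negP => /negP /FG0.
by move/eqP; rewrite mulf_eq0 (negPf p0) (negPf q0).
Qed.

(** Taylor expansion in the variable [j] around [a]. The bound [d] is uniform in [e], so that sums
    over the coefficients have a fixed length. *)
Lemma pf_split D F j a : pf D F ->
  exists (d : nat) (P : (nat -> K) -> {poly K}),
  [/\ forall e, (size (P e) <= d)%N, forall k, pf (D `\ j) (fun e => (P e)`_k) &
      forall e, F e = (P e).[e j - a]].
Proof.
elim=> [c|l [i Di ->]|f g _ [d [P [sP cP fP]]] _ [d' [P' [sP' cP' fP']]]
                     |f g _ [d [P [sP cP fP]]] _ [d' [P' [sP' cP' fP']]]].
- exists 1%N, (fun=> c%:P); split=> [e|k|e]; rewrite ?size_polyC_leq1 ?hornerC //.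
  exact: PolyCst.
- have [->|/eqP ij] := eqVneq i j.
    exists 2%N, (fun=> 'X + a%:P); split=> [e|k|e].
    + by rewrite size_XaddC.
    + exact: PolyCst.
    + by rewrite !hornerE subrK.
  exists 1%N, (fun e => (e i)%:P); split=> [e|k|e].
  + exact: size_polyC_leq1.
  + under eq_fun do rewrite coefC.
    by case: eqP => _; [apply: pf_var; split | exact: PolyCst].
  + by rewrite hornerC.
- exists (maxn d d'), (fun e => P e + P' e); split=> [e|k|e].
  + apply: (leq_trans (size_polyD _ _)).
    by rewrite geq_max !leq_max sP sP' orbT.
  + by under eq_fun do rewrite coefD; apply: PolyAdd.
  + by rewrite hornerD fP fP'.
- exists (d + d')%N, (fun e => P e * P' e); split=> [e|k|e].
  + apply: (leq_trans (size_polyMleq _ _)).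
    by apply: (leq_trans (leq_pred _)); rewrite leq_add.
  + by under eq_fun do rewrite coefM; apply: pf_sum => i; apply: PolyMul.
  + by rewrite hornerM fP fP'.
Qed.

Lemma pf_split_neq0 D F j a : pf D F -> (exists e, F e != 0) ->
  exists (d : nat) (P : (nat -> K) -> {poly K}),
  [/\ forall e, (size (P e) <= d)%N, forall k, pf (D `\ j) (fun e => (P e)`_k),
      forall e, F e = (P e).[e j - a] & exists k e, (P e)`_k != 0].
Proof.
move=> /(pf_split j a)[d [P [sP cP fP]]] [e Fe]; exists d, P; split=> //.
have [k Pk] : exists k, (P e)`_k != 0.
  apply/not_existsP => P0; move: Fe; rewrite fP (_ : P e = 0) ?horner0 ?eqxx //.
  by apply/polyP => k; rewrite coef0; apply/eqP/negP => /negP /P0.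
by exists k, e.
Qed.

(** [m] is the order of vanishing of [F] along the hyperplane [e j = a]: the least index of a Taylor
    coefficient that is not identically zero. On the hyperplane, [H] reduces to that coefficient. *)
Lemma pf_factor D F j a : D j -> pf D F -> (exists e, F e != 0) ->
  exists (m : nat) H, [/\ pf D H, forall e, F e = (e j - a) ^+ m * H e &
    exists e, e j = a /\ H e != 0].
Proof.
move=> Dj pfF /(pf_split_neq0 j a pfF)[d [P [sP cP fP nzP]]].
have exP : exists k, `[< exists e, (P e)`_k != 0 >].
  by case: nzP => k Pk; exists k; apply/asboolP.
case: (ex_minnP exP) => m /asboolP[e0 Pm] minm.
(* The coefficients do not see the variable [j], so the point [e0] may be moved onto the
   hyperplane. *)
have Pj e k : (P (upd e j a))`_k = (P e)`_k.
  apply: (pf_local (cP k)) => i; rewrite inE => -[_ /eqP ij].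
  by rewrite /upd (negPf ij).
exists m, (fun e => \sum_(k < d) (P e)`_(k + m) * (e j - a) ^+ k); split.
- apply: pf_sum => k; apply: PolyMul; first exact: pf_sub (cP _).
  by apply: pf_exp; apply: PolyAdd; [exact: pf_var | exact: PolyCst].
- move=> e; rewrite fP (horner_coef_wide _ (leq_trans (sP e) (leq_addl m d))).
  rewrite big_split_ord /= big1 => [|k _]; last first.
    rewrite (_ : _`_ _ = 0) ?mul0r //; apply/eqP; apply: contraT => Pk.
    have : (m <= k)%N by apply: minm; apply/asboolP; exists e.
    by rewrite leqNgt ltn_ord.
  rewrite add0r mulr_sumr; apply: eq_bigr => k _.
  by rewrite exprD addnC; ring.
- exists (upd e0 j a); rewrite {1}/upd eqxx; split=> //.
  case: d sP => [|d] sP.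
    by move: Pm; rewrite nth_default ?eqxx // (leq_trans (sP _)).
  rewrite big_ord_recl /= big1 => [|k _].
    by rewrite addr0 expr0 mulr1 add0n Pj.
  by rewrite {2}/upd eqxx subrr expr0n mulr0.
Qed.

End PolynomialFunctions.

Local Notation pf D := (poly_fun (coord_fun D)).

(** * Definable sets and quantifier elimination *)

Section Definable.
Variable R : realType.
Implicit Types (v : nat -> R) (Q : set (nat -> R)) (f : ord.formula R).

Lemma nth_set_nth_upd (e : seq R) i x :
  nth 0 (set_nth 0 e i x) = upd (nth 0 e) i x.
Proof. by apply/funext => k; rewrite nth_set_nth. Qed.

Lemma eval_pf (t : GRing.term R) : GRing.rterm t ->
  exists2 F, pf setT F & forall e, GRing.eval e t = F (nth 0 e).
Proof.
elim: t => //=.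
- by move=> i _; exists (fun v => v i) => //; exact: pf_var.
- by move=> c _; exists (fun=> c) => //; exact: PolyCst.
- by move=> n _; exists (fun=> n%:R) => //; exact: PolyCst.
- move=> t IHt u IHu /andP[/IHt[F pfF tF] /IHu[G pfG uG]].
  by exists (fun v => F v + G v) => [|e]; [exact: PolyAdd | rewrite tF uG].
- move=> t IHt /IHt[F pfF tF].
  exists (fun v => -1 * F v) => [|e]; last by rewrite tF mulN1r.
  by apply: PolyMul => //; exact: PolyCst.
- move=> t IHt n /IHt[F pfF tF].
  exists (fun v => n%:R * F v) => [|e]; last by rewrite tF mulr_natl.
  by apply: PolyMul => //; exact: PolyCst.
- move=> t IHt u IHu /andP[/IHt[F pfF tF] /IHu[G pfG uG]].
  by exists (fun v => F v * G v) => [|e]; [exact: PolyMul | rewrite tF uG].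
- move=> t IHt n /IHt[F pfF tF].
  by exists (fun v => F v ^+ n) => [|e]; [exact: pf_exp | rewrite tF].
Qed.

Lemma pf_eval D F : pf D F ->
  exists t : GRing.term R, forall e, GRing.eval e t = F (nth 0 e).
Proof.
elim=> [c|l [i _ ->]|F1 F2 _ [t tF] _ [u uF]|F1 F2 _ [t tF] _ [u uF]].
- by exists (GRing.Const c).
- by exists (GRing.Var _ i).
- by exists (GRing.Add t u) => e /=; rewrite tF uF.
- by exists (GRing.Mul t u) => e /=; rewrite tF uF.
Qed.

(** Only environments of finite support are tested; an arbitrary environment must first be replaced
    by a list, using that finitely many variables matter. *)
Definition definable Q :=
  exists f, forall e : seq R, ord.holds e f <-> Q (nth 0 e).

Lemma definable_eq0 D F : pf D F -> definable [set v | F v = 0].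
Proof.
by move=> /pf_eval[t tF]; exists (ord.Equal t (GRing.Const 0)) => e /=; rewrite tF.
Qed.

Lemma definable_gt0 D F : pf D F -> definable [set v | 0 < F v].
Proof.
by move=> /pf_eval[t tF]; exists (ord.Lt (GRing.Const 0) t) => e /=; rewrite tF.
Qed.

Lemma definableI Q Q' : definable Q -> definable Q' -> definable (Q `&` Q').
Proof.
move=> [f fQ] [g gQ]; exists (ord.And f g) => e /=.
by rewrite fQ gQ.
Qed.

Lemma definable_forall n (Q : 'I_n -> set (nat -> R)) :
  (forall i, definable (Q i)) -> definable [set v | forall i, Q i v].
Proof.
move=> /choice[f fQ].
exists (foldr (@ord.And R) (ord.Bool true) (map f (enum 'I_n))) => e.
apply: (@iff_trans _ (forall i, i \in enum 'I_n -> Q i (nth 0 e))).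
  elim: (enum 'I_n) => [|i r IH] /=; first by split.
  rewrite fQ IH; split=> [[Qi Qr] k|Qr].
    by rewrite inE => /predU1P[->|/Qr].
  by split=> [|k kr]; apply: Qr; rewrite inE ?eqxx ?kr ?orbT.
by split=> Qe i => [|_]; apply: Qe; rewrite mem_enum.
Qed.

Lemma definable_exists n (Q : 'I_n -> set (nat -> R)) :
  (forall i, definable (Q i)) -> definable [set v | exists i, Q i v].
Proof.
move=> /choice[f fQ].
exists (foldr (@ord.Or R) (ord.Bool false) (map f (enum 'I_n))) => e.
apply: (@iff_trans _ (exists2 i, i \in enum 'I_n & Q i (nth 0 e))).
  elim: (enum 'I_n) => [|i r IH] /=; first by split=> // -[].
  rewrite fQ IH; split=> [[Qi|[k kr Qk]]| [k]].
  - by exists i; rewrite ?mem_head.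
  - by exists k; rewrite // inE kr orbT.
  - by rewrite inE => /predU1P[->|kr Qk]; [left | right; exists k].
by split=> [[i _ Qi]|[i Qi]]; exists i; rewrite ?mem_enum.
Qed.

(** The block is read from [y] at the same indices, without a shift, so that one more quantifier
    amounts to a single [upd]. *)
Definition upds v k m (y : nat -> R) : nat -> R :=
  fun i => if (k <= i < k + m)%N then y i else v i.

Lemma definable_proj Q k m : definable Q ->
  definable [set v | exists y, Q (upds v k m y)].
Proof.
elim: m Q => [|m IH] Q [f fQ].
  exists f => e; rewrite fQ.
  have E y : upds (nth 0 e) k 0 y = nth 0 e.
    by apply/funext => i; rewrite /upds addn0 leqNgt andNb.
  by split=> [Qe| [y]]; [exists (fun=> 0)|]; rewrite E.
have /IH[g gQ] : definable [set v | exists x, Q (upd v (k + m) x)].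
  exists (ord.Exists (k + m) f) => e /=.
  by split=> -[x]; rewrite ?fQ ?nth_set_nth_upd => Qx; exists x;
    rewrite ?fQ ?nth_set_nth_upd.
exists g => e; rewrite gQ; split.
  move=> [y [x Qx]]; exists (upd y (k + m) x); congr Q: Qx.
  apply/funext => i; rewrite /upd /upds addnS ltnS.
  by case: eqP => [->|/eqP ne]; rewrite ?leq_addr ?leqnn // ltn_neqAle ne.
move=> [y Qy]; exists y, (y (k + m)%N); congr Q: Qy.
apply/funext => i; rewrite /upd /upds addnS ltnS.
by case: eqP => [->|/eqP ne]; rewrite ?leq_addr ?leqnn // ltn_neqAle ne.
Qed.

(** Quantifier elimination over the real closed field [R]. Clearing inverses first, by [to_rform],
    leaves polynomial atoms, as [eval_pf] requires. *)
Lemma quantifier_free_definable Q : definable Q ->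
  exists f, [/\ ord.qf_form f, ord.rformula f &
    forall e : seq R, ord.qf_eval e f <-> Q (nth 0 e)].
Proof.
move=> [f fQ]; exists (ord.quantifier_elim (@wproj R) (ord.to_rform f)).
have /andP[qf rf] : ord.qf_form (ord.quantifier_elim (@wproj R) (ord.to_rform f))
    && ord.rformula (ord.quantifier_elim (@wproj R) (ord.to_rform f)).
  by apply: ord.quantifier_elim_wf;
    [exact: wf_QE_wproj | exact: ord.to_rform_rformula].
split=> // e; rewrite -fQ; exact: iff_sym (rwP (rcf_satP e f)).
Qed.

Lemma near_sgr_horner (p : {poly R}) a : p.[a] != 0 ->
  \forall x \near a, Num.sg p.[x] = Num.sg p.[a].
Proof.
have pa : p.[x] @[x --> a] --> p.[a] by exact: continuous_horner.
rewrite neq_lt => /orP[p0|p0].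
  have px := cvgr_lt _ pa _ p0; near=> x.
  have hx : p.[x] < 0 by near: x; exact: px.
  by rewrite !ltr0_sg.
have px := cvgr_gt _ pa _ p0; near=> x.
have hx : 0 < p.[x] by near: x; exact: px.
by rewrite !gtr0_sg.
Unshelve. all: by end_near.
Qed.

(* F is the product of the atoms of f that are not identically zero. *)
Lemma qf_locally_constant f j : ord.qf_form f -> ord.rformula f ->
  exists2 F, pf setT F & (exists v, F v != 0) /\
    forall e : seq R, F (nth 0 e) != 0 ->
    \forall t \near nth 0 e j, ord.qf_eval (set_nth 0 e j t) f = ord.qf_eval e f.
Proof.
(* All three kinds of atoms are determined by the sign of [t - u]. If this difference is identically
   zero, the atom is constant and [F = 1] serves. *)
have atom t u (op : R -> bool) b : GRing.rterm t -> GRing.rterm u ->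
  (forall e, b e = op (Num.sg (GRing.eval e t - GRing.eval e u))) ->
  exists2 F, pf setT F & (exists v, F v != 0) /\
    forall e : seq R, F (nth 0 e) != 0 ->
    \forall s \near nth 0 e j, b (set_nth 0 e j s) = b e.
  move=> /eval_pf[F pfF tF] /eval_pf[G pfG uG] bE.
  pose H v := F v + (-1) * G v.
  have pfH : pf setT H by apply: PolyAdd => //; apply: PolyMul => //; exact: PolyCst.
  have HE v : F v - G v = H v by rewrite /H mulN1r.
  have [nzH|zH] := pselect (exists v, H v != 0); last first.
    exists (fun=> 1); first exact: PolyCst.
    split=> [|e _]; first by exists (fun=> 0); rewrite oner_eq0.
    apply: (@filterE _ (nbhs _) (nbhs_filter _)) => s; rewrite !bE !tF !uG.
    have H0 v : F v - G v = 0.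
      by apply/eqP/negP => /negP FG; apply: zH; exists v; rewrite -HE.
    by rewrite !H0.
  exists H => //; split=> // e He.
  have [p Hp] := pf_upd_line (nth 0 e) j pfH.
  have updE : upd (nth 0 e) j (nth 0 e j) = nth 0 e.
    by apply/funext => i; rewrite /upd; case: eqP => // ->.
  have : p.[nth 0 e j] != 0 by rewrite -Hp updE.
  move=> /near_sgr_horner; apply: filterS => s.
  by rewrite !bE !tF !uG nth_set_nth_upd !HE Hp => ->; rewrite -Hp updE.
have conn f1 f2 b (op : bool -> bool -> bool) :
  (exists2 F, pf setT F & (exists v, F v != 0) /\
    forall e : seq R, F (nth 0 e) != 0 -> \forall t \near nth 0 e j,
      ord.qf_eval (set_nth 0 e j t) f1 = ord.qf_eval e f1) ->
  (exists2 F, pf setT F & (exists v, F v != 0) /\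
    forall e : seq R, F (nth 0 e) != 0 -> \forall t \near nth 0 e j,
      ord.qf_eval (set_nth 0 e j t) f2 = ord.qf_eval e f2) ->
  (forall e, b e = op (ord.qf_eval e f1) (ord.qf_eval e f2)) ->
  exists2 F, pf setT F & (exists v, F v != 0) /\
    forall e : seq R, F (nth 0 e) != 0 ->
    \forall t \near nth 0 e j, b (set_nth 0 e j t) = b e.
  move=> [F pfF [nzF Fc]] [G pfG [nzG Gc]] bE.
  exists (fun v => F v * G v); first exact: PolyMul.
  split=> [|e]; first exact: pf_mul_neq0 pfF pfG nzF nzG.
  rewrite mulf_eq0 negb_or => /andP[/Fc + /Gc]; apply: filterS2 => t.
  by rewrite !bE => -> ->.
elim: f => //=.
- move=> b _ _; exists (fun=> 1); first exact: PolyCst.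
  split=> [|e _]; first by exists (fun=> 0); rewrite oner_eq0.
  exact: (@filterE _ (nbhs _) (nbhs_filter _)).
- move=> t u _ /andP[rt ru]; apply: (atom t u (fun x => x == 0)) => // e.
  by rewrite sgr_eq0 subr_eq0.
- move=> t u _ /andP[rt ru]; apply: (atom t u (fun x => x < 0)) => // e.
  by rewrite sgr_lt0 subr_lt0.
- move=> t u _ /andP[rt ru]; apply: (atom t u (fun x => x <= 0)) => // e.
  by rewrite sgr_le0 subr_le0.
- move=> f1 IH1 f2 IH2 /andP[q1 q2] /andP[r1 r2].
  exact: (conn _ _ _ andb (IH1 q1 r1) (IH2 q2 r2)).
- move=> f1 IH1 f2 IH2 /andP[q1 q2] /andP[r1 r2].
  exact: (conn _ _ _ orb (IH1 q1 r1) (IH2 q2 r2)).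
- move=> f1 IH1 f2 IH2 /andP[q1 q2] /andP[r1 r2].
  exact: (conn _ _ _ implb (IH1 q1 r1) (IH2 q2 r2)).
- move=> f1 IH1 q1 r1.
  (* Negation is treated as a binary connective that ignores its second argument. *)
  exact: (conn _ _ _ (fun b _ => ~~ b) (IH1 q1 r1) (IH1 q1 r1)).
Qed.

(** At a point of [Q] where [F] is nonzero, a small change of the variable [j] would stay in [Q],
    against the uniqueness of its value. The variables from [k] on are frozen at a point [v0] where
    [F] is nonzero: this bounds the variables and keeps the polynomial nonzero. *)
Lemma definable_graph_pf Q j k : (j < k)%N -> definable Q ->
  (forall v v', {in gtn k, v =1 v'} -> Q v -> Q v') ->
  (forall v t, Q v -> Q (upd v j t) -> t = v j) ->
  exists F, [/\ pf `I_k F, exists v, F v != 0 &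
    forall v, Q v -> F v = 0].
Proof.
move=> jk /quantifier_free_definable[f [qf rf fQ]] Qk Qj.
have [F pfF [[v0 Fv0] Fc]] := qf_locally_constant j qf rf.
have [N pfFN] := pf_finite pfF.
(* The list agrees with [v] below [k], which preserves [Q], and is long enough for the variables of
   [F]. *)
pose w v := mkseq (fun i => if (i < k)%N then v i else v0 i) (maxn k N).
exists (fun v => F (fun i => if (i < k)%N then v i else v0 i)); split.
- apply: (poly_fun_comp _ pfF) => l [i _ ->] /=; rewrite /comp /=.
  by case: ltnP => ik; [exact: pf_var | exact: PolyCst].
- exists v0; congr (F _ != 0): Fv0; apply/funext => i; by case: ifP.
- move=> v Qv; apply/eqP; apply: contraT => Fv.
  have wE i : (i < maxn k N)%N -> nth 0 (w v) i = if (i < k)%N then v i else v0 i.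
    by move=> iN; rewrite nth_mkseq.
  have Fw : F (nth 0 (w v)) != 0.
    rewrite (pf_local (e' := fun i => if (i < k)%N then v i else v0 i) pfFN) // => i.
    by rewrite inE => -[_ /= iN]; apply: wE; rewrite leq_max iN orbT.
  have Qw : Q (nth 0 (w v)).
    by apply: Qk Qv => i; rewrite inE /= => ik; rewrite wE ?ik // leq_max ik.
  have /fQ Qwb := Qw.
  have near_f := Fc _ Fw.
  (* Punctured neighbourhoods in [R] are nonempty, so some other value [t] of the variable [j] keeps
     the formula true. *)
  have /filter_ex[t [tf /eqP tj]] : (nth 0 (w v) j)^'
      [set t | ord.qf_eval (set_nth 0 (w v) j t) f /\ t != nth 0 (w v) j].
    rewrite /dnbhs /within /=; apply: filterS near_f => t -> tj; split=> //.
  by case: tj; apply: Qj Qw _; rewrite -nth_set_nth_upd; exact/fQ.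
Qed.

End Definable.

(** * Coordinates *)

Section Coordinates.
Variable R : realType.
Implicit Types (V : vectType R[i]) (v : nat -> R) (a : nat -> R[i]).

Definition vec_of V a : V := vecof (vbasis {:V}) (\row_j a j).

Lemma eq_vec_of V a a' : {in gtn (\dim {:V}), a =1 a'} -> vec_of V a = vec_of V a'.
Proof.
by move=> aa'; congr vecof; apply/rowP => j; rewrite !mxE aa' // inE /=.
Qed.

Lemma coord_vec_of V a j : coord (vbasis {:V}) j (vec_of V a) = a j.
Proof. by rewrite /vec_of coord_vecof ?vbasisP // mxE. Qed.

Definition coords V (x : V) : nat -> R[i] :=
  fun j => if insub j is Some i then coord (vbasis {:V}) i x else 0.

Lemma coordsK V (x : V) : vec_of V (coords x) = x.
Proof.
rewrite /vec_of -[RHS](rVofK (vbasisP {:V})); congr vecof; apply/rowP => j.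
by rewrite !mxE /coords valK.
Qed.

Lemma real_linearD V (l : V -> R) u w : real_linear l -> l (u + w) = l u + l w.
Proof. by move=> /(_ 1 u w); rewrite rmorph1 scale1r mul1r. Qed.

Lemma real_linear0 V (l : V -> R) : real_linear l -> l 0 = 0.
Proof.
by move=> ll; apply: (@addrI _ (l 0)); rewrite -real_linearD // !addr0.
Qed.

Lemma real_linearZ V (l : V -> R) c u : real_linear l -> l (c%:C *: u) = c * l u.
Proof. by move=> ll; rewrite -[_ *: _]addr0 ll real_linear0 // addr0. Qed.

(** A polynomial parametrisation of [V] seen as a real space. Testing on all real linear functionals
    matches the generators of [real_poly_fun] and avoids a real basis. *)
Definition pf_param V (h : (nat -> R) -> V) :=
  forall l, real_linear l -> pf setT (l \o h).

Lemma pf_paramD V (h h' : (nat -> R) -> V) :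
  pf_param h -> pf_param h' -> pf_param (fun v => h v + h' v).
Proof.
move=> ph ph' l ll; rewrite (_ : _ \o _ = fun v => l (h v) + l (h' v)).
  by apply: PolyAdd; [exact: ph | exact: ph'].
by apply/funext => v /=; rewrite real_linearD.
Qed.

Lemma pf_param_sum V (I : Type) (r : seq I) (h : I -> (nat -> R) -> V) :
  (forall i, pf_param (h i)) -> pf_param (fun v => \sum_(i <- r) h i v).
Proof.
move=> ph; elim: r => [|i r IH].
  under eq_fun do rewrite big_nil.
  move=> l ll; rewrite (_ : _ \o _ = fun=> 0); first exact: PolyCst.
  by apply/funext => v /=; rewrite real_linear0.
by under eq_fun do rewrite big_cons; apply: pf_paramD.
Qed.

Lemma pf_paramZ V i (u : V) : pf_param (fun v => (v i)%:C *: u).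
Proof.
move=> l ll; rewrite (_ : _ \o _ = fun v => v i * l u).
  by apply: PolyMul; [exact: pf_var | exact: PolyCst].
by apply/funext => v /=; rewrite real_linearZ.
Qed.

Lemma pf_param_vec_of V p q :
  pf_param (fun v => vec_of V (fun j => v (p + j)%N +i* v (q + j)%N)).
Proof.
apply: pf_param_sum => j.
under eq_fun do rewrite mxE [_ +i* _]complexE /= scalerDl.
apply: pf_paramD; first exact: pf_paramZ.
by under eq_fun do rewrite mulrC -scalerA; exact: pf_paramZ.
Qed.

Lemma pf_param_pair V (W : vectType R[i]) (h : (nat -> R) -> V)
    (h' : (nat -> R) -> W) :
  pf_param h -> pf_param h' -> pf_param (fun v => (h v, h' v) : (V * W)%type).
Proof.
move=> ph ph' l ll.
rewrite (_ : _ \o _ = fun v => l (h v, 0) + l (0, h' v)); last first.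
  by apply/funext => v /=; rewrite -real_linearD //; congr l;
    apply/pair_equal_spec; rewrite /= addr0 add0r.
apply: PolyAdd.
  apply: (ph (fun u => l (u, 0))) => c u w.
  by rewrite -ll; congr l; apply/pair_equal_spec; rewrite /= scaler0 addr0.
apply: (ph' (fun u => l (0, u))) => c u w.
by rewrite -ll; congr l; apply/pair_equal_spec; rewrite /= scaler0 addr0.
Qed.

Lemma definable_semialgebraic V (A : set V) (h : (nat -> R) -> V) :
  semialgebraic A -> pf_param h -> definable [set v | A (h v)].
Proof.
move=> [k [B [Bs ->]]] ph.
have pfh f : real_poly_fun f -> pf setT (f \o h) by exact: poly_fun_comp.
have -> : [set v | (\bigcup_i B i) (h v)] = [set v | exists i, B i (h v)].
  by apply/seteqP; split=> v [j] => [_|] Bj; exists j.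
apply: definable_exists => i; have [r [s [f [g [pf_f pf_g ->]]]]] := Bs i.
apply: definableI; apply: definable_forall => j.
- by apply: definable_eq0; apply: pfh.
- by apply: definable_gt0; apply: pfh.
Qed.

Definition real_env n a (t s : R) : nat -> R := fun i =>
  if (i < n)%N then complex.Re (a i)
  else if (i < n + n)%N then complex.Im (a (i - n)%N)
  else if i == (n + n)%N then t else s.

(** Mixing the real and imaginary parts with a free parameter [s] lets one real relation carry both;
    the later choice [s = 'i] recovers [f]. Eliminating [y] leaves a set on which [t] is a function
    of the other variables. *)
Lemma semialgebraic_component (M N : vectType R[i]) (Omega : set M)
    (phi : M -> N) (c : 'I_(\dim {:N})) (n := \dim {:M})
    (f := fun a => coord (vbasis {:N}) c (phi (vec_of M a))) :
  semialgebraic (graph_on Omega phi) ->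
  exists F, [/\ pf `I_((n + n).+2) F, exists v, F v != 0 &
    forall a s, Omega (vec_of M a) ->
      F (real_env n a (complex.Re (f a) + s * complex.Im (f a)) s) = 0].
Proof.
move=> sg.
(* The variables are Re x, Im x, t, s, Re y, Im y in this order. *)
pose k := (n + n).+2; pose m := \dim {:N}.
pose X v := vec_of M (fun j => v (0 + j)%N +i* v (n + j)%N).
pose Y v := vec_of N (fun j => v (k + j)%N +i* v (k + m + j)%N).
(* The second set is the equation t = Re y_c + s Im y_c. *)
pose Q0 := [set v | graph_on Omega phi (X v, Y v)] `&`
  [set v | v (n + n)%N +
    -1 * (v (k + c)%N + v (n + n).+1 * v (k + m + c)%N) = 0].
have defQ0 : definable Q0.
  apply: definableI.
    apply: definable_semialgebraic sg _.
    by apply: pf_param_pair; apply: pf_param_vec_of.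
  apply: (@definable_eq0 _ setT); do ?[apply: PolyAdd | apply: PolyMul];
    solve [exact: pf_var | exact: PolyCst].
have XP v v' : {in gtn (n + n), v =1 v'} -> X v = X v'.
  move=> vv'; apply: eq_vec_of => j; rewrite inE /= -/n => jn.
  by rewrite !vv' // inE /=; lia.
have Q0P v v' : {in gtn (k + (m + m)), v =1 v'} -> Q0 v -> Q0 v'.
  have cm : (c < m)%N by [].
  move=> vv' [/=]; rewrite (XP v v') => [|j]; last first.
    by rewrite inE /= => jk; rewrite vv' // inE /=; lia.
  have -> : Y v = Y v'.
    apply: eq_vec_of => j; rewrite inE /= -/m => jm.
    by rewrite !vv' // inE /=; lia.
  by rewrite !vv' // inE /= /k; lia.
pose Q := [set v | exists y, Q0 (upds v k (m + m) y)].
have Qloc v v' : {in gtn k, v =1 v'} -> Q v -> Q v'.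
  move=> vv' [y Qy]; exists y; apply: Q0P Qy => i; rewrite inE /= => ik.
  by rewrite /upds; case: ifP => // nik; apply: vv'; rewrite inE /=; lia.
(* The first [n + n] variables fix the point of [M], hence [y] through [phi]; as [s] is unchanged,
   [t] is determined. *)
have Qfun v t : Q v -> Q (upd v (n + n) t) -> t = v (n + n)%N.
  have low (w y : nat -> R) i : (i < k)%N -> upds w k (m + m) y i = w i.
    by move=> ik; rewrite /upds; case: ifP => //; lia.
  have cm : (c < m)%N by [].
  move=> [y [[/= _ Yy] /eqP]] + [y' [[/= _ Yy'] /eqP]].
  rewrite !mulN1r !subr_eq0 !(low _ _ (n + n)%N) ?(low _ _ (n + n).+1) // /upd.
  rewrite eqxx ifF; last by lia.
  move=> /eqP vn /eqP tn.
  have eY : Y (upds v k (m + m) y) = Y (upds (upd v (n + n) t) k (m + m) y').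
    rewrite Yy Yy'; congr phi; apply: XP => i; rewrite inE /= => ik.
    by rewrite !low ?/upd ?ifF //; lia.
  have eb j : (j < m)%N -> upds v k (m + m) y (k + j)%N
      = upds (upd v (n + n) t) k (m + m) y' (k + j)%N /\
    upds v k (m + m) y (k + m + j)%N
      = upds (upd v (n + n) t) k (m + m) y' (k + m + j)%N.
    move=> jm; have := congr1 (coord (vbasis {:N}) (Ordinal jm)) eY.
    by rewrite !coord_vec_of => -[].
  by rewrite vn tn; have [-> ->] := eb c cm.
have [F [pfF nzF F0]] := definable_graph_pf (leqnSn _ : (n + n < k)%N)
    (definable_proj k (m + m) defQ0) Qloc Qfun.
exists F; split=> // a s Oa; apply: F0; set v := real_env n a _ s.
pose b := coords (phi (vec_of M a)); have bE : vec_of N b = _ := coordsK _.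
(* The eliminated variables receive the real and imaginary parts of the coordinates of the value of
   [phi]. *)
exists (fun i => if (i < k + m)%N then complex.Re (b (i - k)%N)
                 else complex.Im (b (i - (k + m))%N)).
set y := fun i => _.
have yE j : (j < m)%N -> upds v k (m + m) y (k + j)%N = complex.Re (b j)
    /\ upds v k (m + m) y (k + m + j)%N = complex.Im (b j).
  move=> jm; rewrite /upds /y; split; first by rewrite ifT ?ifT ?addKn //; lia.
  by rewrite ifT ?ifF ?addKn //; lia.
have cm : (c < m)%N by [].
have low i : (i < k)%N -> upds v k (m + m) y i = v i.
  by move=> ik; rewrite /upds; case: ifP => //; lia.
have XE : X (upds v k (m + m) y) = vec_of M a.
  apply: eq_vec_of => j; rewrite inE /= -/n => jn.
  rewrite !low ?/v ?/real_env ?add0n; do ?lia.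
  by rewrite jn ifF ?ifT ?addKn; [case: (a j) | lia | lia].
split; first split.
- by rewrite /= XE.
- rewrite /= XE -bE; apply: eq_vec_of => j; rewrite inE /= -/m => jm.
  by have [-> ->] := yE j jm; case: (b j).
- have nk : (n + n < k)%N by [].
  have nk1 : ((n + n).+1 < k)%N by [].
  have [yRe yIm] := yE c cm.
  rewrite /= (low _ nk) (low _ nk1) yRe yIm /v /real_env eqxx.
  do 5!(rewrite ifF; last lia).
  by rewrite /f -bE coord_vec_of mulN1r subrr.
Qed.

End Coordinates.

(** * Passing to complex variables *)

Section Complexification.
Variable R : realType.
Implicit Types (a w e : nat -> R[i]).

Lemma pf_complexify D (F : (nat -> R) -> R) : pf D F ->
  exists2 G : (nat -> R[i]) -> R[i], pf D G &
    forall v, G (fun i => (v i)%:C) = (F v)%:C.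
Proof.
elim=> [c|l [i Di ->]|F1 F2 _ [G1 p1 E1] _ [G2 p2 E2]
                     |F1 F2 _ [G1 p1 E1] _ [G2 p2 E2]].
- by exists (fun=> c%:C) => //; exact: PolyCst.
- by exists (fun e => e i) => //; exact: pf_var.
- exists (fun e => G1 e + G2 e) => [|v]; first exact: PolyAdd.
  by rewrite E1 E2 rmorphD.
- exists (fun e => G1 e * G2 e) => [|v]; first exact: PolyMul.
  by rewrite E1 E2 rmorphM.
Qed.

(** The layout of [real_env], with [a] and [w] (later the conjugates of [a]) as independent
    variables in place of the real and imaginary parts. *)
Definition complex_env n a w (t s : R[i]) : nat -> R[i] := fun i =>
  if (i < n)%N then a i else if (i < n + n)%N then w (i - n)%N
  else if i == (n + n)%N then t else s.

(* Inverts (x, y) |-> (x + 'i y, x - 'i y). *)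
Definition real_coords n e : nat -> R[i] := fun i =>
  if (i < n)%N then (e i + e (n + i)%N) / 2
  else if (i < n + n)%N then (e (i - n)%N - e i) / (2 * 'i%C) else e i.

Let I2_neq0 : 2 * 'i%C != 0 :> R[i].
Proof. by rewrite mulf_neq0 ?pnatr_eq0 // eq_complex /= oner_eq0 andbF. Qed.

Lemma real_coords_env n a (t s : R) :
  real_coords n (complex_env n a (fun j => (a j)^*%C) t%:C s%:C) =
  fun i => (real_env n a t s i)%:C.
Proof.
apply/funext => i; rewrite /real_coords /complex_env /real_env.
case: ltnP => [ni|ni].
  rewrite ifF; last lia.
  by rewrite ltn_add2l ni addKn ReJ_add.
case: ltnP => nni.
  rewrite ifT; last lia.
  by rewrite subcJ [2 * _ * _]mulrAC mulrC mulKf.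
by case: ifP.
Qed.

(** Reaching the real points is enough to show that composing with [real_coords] does not make a
    nonzero real relation vanish identically. *)
Lemma real_coords_surj n (v : nat -> R) :
  exists e, real_coords n e = fun i => (v i)%:C.
Proof.
exists (fun i => if (i < n)%N then (v i)%:C + 'i%C * (v (n + i)%N)%:C
  else if (i < n + n)%N then (v (i - n)%N)%:C - 'i%C * (v i)%:C else (v i)%:C).
have n2 : 2 != 0 :> R[i] by rewrite pnatr_eq0.
have ni : 'i%C != 0 :> R[i] by move: I2_neq0; rewrite mulf_eq0 negb_or => /andP[].
apply/funext => i; rewrite /real_coords.
case: ltnP => [ni'|ni'].
  rewrite ifF; last lia.
  by rewrite ltn_add2l ni' addKn; field.
case: ltnP => nni.
  rewrite ifT; last lia.
  by rewrite subnKC //; field; rewrite ni.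
by [].
Qed.

Lemma pf_real_coords n (G : (nat -> R[i]) -> R[i]) (N := (n + n).+2) :
  pf `I_N G -> pf `I_N (G \o real_coords n).
Proof.
apply: poly_fun_comp => l [i /= iN ->]; rewrite /comp /real_coords.
case: ltnP => [ni|ni].
  apply: PolyMul; last exact: PolyCst.
  by apply: PolyAdd; apply: pf_var; rewrite /= /N; lia.
case: ltnP => nni; last exact: pf_var.
apply: PolyMul; last exact: PolyCst.
apply: PolyAdd; first by apply: pf_var; rewrite /= /N; lia.
rewrite (_ : (fun x => - _) = (fun x => -1 * x i)); last first.
  by apply/funext => x; rewrite mulN1r.
by apply: PolyMul; [exact: PolyCst | exact: pf_var].
Qed.

(** Substituting [s = 'i] could kill the relation, so the largest power of [s - 'i] is split off
    first; the remaining factor is nonzero somewhere on [s = 'i]. The final 0 in the conclusion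
    fills the slot of [s], which no longer occurs. *)
Lemma real_relation_complex n (O : set (nat -> R[i])) (f : (nat -> R[i]) -> R[i])
    (F : (nat -> R) -> R) : pf `I_((n + n).+2) F -> (exists v, F v != 0) ->
  (forall a s, O a ->
     F (real_env n a (complex.Re (f a) + s * complex.Im (f a)) s) = 0) ->
  exists G, [/\ pf `I_((n + n).+1) G, exists e, G e != 0 &
    forall a, O a -> G (complex_env n a (fun j => (a j)^*%C) (f a) 0) = 0].
Proof.
move=> /pf_complexify[G0 pfG0 G0E] [v Fv] F0.
have nzG0 : exists e, (G0 \o real_coords n) e != 0.
  have [e eE] := real_coords_surj n v; exists e.
  by rewrite /= eE G0E; apply: contra_neq Fv => /complexI.
have [m [H [pfH HE [e [ei He]]]]] :=
  pf_factor 'i%C (ltnSn _ : `I_((n + n).+2) (n + n).+1) (pf_real_coords pfG0) nzG0.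
exists (fun e => H (upd e (n + n).+1 'i%C)); split.
- apply: (poly_fun_comp _ pfH) => l [i /= iN ->]; rewrite /comp /upd.
  by case: eqP => ij; [exact: PolyCst | apply: pf_var => /=; lia].
- exists e; congr (H _ != 0) : He; apply/funext => i.
  by rewrite /upd; case: eqP => [->|].
- move=> a Oa; set e0 := complex_env n a _.
  (* The direction in which [s] grows by 1 and [t] by Im f(a), the other variables being fixed. *)
  pose d i : R[i] := if (i < n + n)%N then 0 else
    if i == (n + n)%N then (complex.Im (f a))%:C else 1.
  have [p pE] := pf_line (e0 (complex.Re (f a))%:C 0) d pfH.
  have lineE s : (fun i => e0 (complex.Re (f a))%:C 0 i + s * d i) =
      e0 ((complex.Re (f a))%:C + s * (complex.Im (f a))%:C) s.
    apply/funext => i; rewrite /e0 /complex_env /d.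
    case: ltnP => [ni|ni]; first by rewrite ifT ?mulr0 ?addr0 //; lia.
    case: ltnP => nni; first by rewrite mulr0 addr0.
    by case: eqP => _; rewrite ?mulr1 ?add0r.
  (* For natural [s] the factor [s - 'i] is nonzero, so [H] vanishes there; infinitely many zeros
     force [p = 0]. *)
  have p0 : p = 0.
    apply: poly_zeros_eq0 => k; rewrite -pE lineE.
    have := HE (e0 ((complex.Re (f a))%:C + k%:R * (complex.Im (f a))%:C) k%:R).
    have -> : k%:R = k%:R%:C :> R[i] by rewrite rmorph_nat.
    rewrite -rmorphM -rmorphD /= real_coords_env G0E F0 // => /esym/eqP.
    rewrite mulf_eq0 expf_eq0 => /orP[/andP[_]|/eqP //].
    rewrite /e0 /complex_env; do 3!(rewrite ifF; last lia).
    by rewrite subr_eq0 eq_complex /= andbC eq_sym oner_eq0.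
  (* At [s = 'i] the variable [t] becomes Re f(a) + i Im f(a) = f(a). *)
  transitivity (p.['i%C]); last by rewrite p0 horner0.
  rewrite -pE lineE -complexE; apply: (pf_local pfH) => i; rewrite inE /= => iN.
  rewrite /upd /e0 /complex_env; case: eqP => [->|ij].
    by do 3!(rewrite ifF; last lia).
  by do 3!case: ifP => //; move=> *; lia.
Qed.

End Complexification.

(** * Removing the conjugate variables *)

Section Holomorphic.
Variable R : realType.
Local Notation C := R[i].

(** Radii of balls in [R[i]] are themselves complex numbers; the order on [R[i]] makes the positive
    ones real. *)
Lemma gt0_Re (d : C) : 0 < d -> 0 < complex.Re d /\ d = (complex.Re d)%:C.
Proof. by case: d => a b; rewrite ltcE /= => /andP[/eqP -> ->]. Qed.

(** A complex derivative can be computed along any single direction; along [u], all difference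
    quotients close to [z0] are zero. *)
Lemma derive_line_eq0 (g : C -> C) (z0 u l : C) :
  `|u| = 1 -> is_derive z0 (1 : C) g l ->
  (\forall z \near z0, (exists r : R, z = z0 + r%:C * u) -> g z = 0) -> l = 0.
Proof.
move=> u1 [gd gl] g0.
have gz0 : g z0 = 0.
  by apply: (nbhs_singleton g0); exists 0; rewrite mul0r addr0.
apply/eqP; apply: contraT => l0.
have lim : h^-1 *: (g (h *: 1 + z0) - g z0) @[h --> (0 : C)^'] --> l by rewrite -gl.
have l_gt0 : 0 < `|l| by rewrite normr_gt0.
move/cvgrPdist_lt: lim => /(_ _ l_gt0) /nbhs_ballP[e1 /gt0_Re[d1 e1E] bl].
move: g0 => /nbhs_ballP[e2 /gt0_Re[d2 e2E] b0].
rewrite e1E in bl; rewrite e2E in b0.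
set r1 := complex.Re e1 in d1 bl; set r2 := complex.Re e2 in d2 b0.
(* Half the smaller radius puts z0 + r u in both balls: the quotient there is within |l| of l, yet
   it is zero. *)
pose r := Num.min r1 r2 / 2.
have rmin : r < Num.min r1 r2 by rewrite ltr_pdivrMr // ltr_pMr ?lt_min ?d1 ?ltr1n.
have r_gt0 : 0 < r by rewrite divr_gt0 // lt_min d1.
have normh : `|r%:C * u| = r%:C by rewrite normrM u1 mulr1 ger0_norm // lecR ltW.
have h0 : r%:C * u != 0 by rewrite -normr_eq0 normh eq_complex /= gt_eqF.
have : `|l - (r%:C * u)^-1 *: (g (r%:C * u *: 1 + z0) - g z0)| < `|l|.
  apply: (bl _ _ h0).
  rewrite -ball_normE /ball_ /= sub0r normrN normh ltcR.
  by rewrite (lt_le_trans rmin) // ge_min lexx.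
rewrite (b0 (r%:C * u *: 1 + z0)); first by rewrite gz0 subrr scaler0 subr0 ltxx.
  rewrite -ball_normE /ball_ /= [_ *: 1]mulr1 opprD addrCA subrr addr0 normrN normh.
  by rewrite ltcR (lt_le_trans rmin) // ge_min lexx orbT.
by exists r; rewrite [_ *: 1]mulr1 addrC.
Qed.

Lemma is_deriveM_fun (f g : C -> C) (z df dg : C) :
  is_derive z (1 : C) f df -> is_derive z (1 : C) g dg ->
  is_derive z (1 : C) (fun x => f x * g x) (f z * dg + g z * df).
Proof. by move=> Hf Hg; exact: is_derive_eq (is_deriveM Hf Hg) _. Qed.

(** The affine function will stand for the conjugate of [x] along a line. For [k = 0] the truncated
    exponent [k.-1] is harmless, being multiplied by 0. *)
Lemma is_derive_affineX (w c z : C) k :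
  is_derive z (1 : C) (fun x => (w + c * (x - z)) ^+ k) (k%:R * w ^+ k.-1 * c).
Proof.
elim: k => [|k IH].
  rewrite mul0r mul0r (_ : (fun x => _) = cst 1); first exact: is_derive_cst.
  by apply/funext => x; rewrite expr0.
have affine : is_derive z (1 : C) (fun x => w + c * (x - z)) c.
  have shift_id : is_derive z (1 : C) (fun x : C => x - z) 1.
    exact: (@is_derive_shift _ z 1 (- z)).
  apply: is_derive_eq (is_deriveD (is_derive_cst w z 1)
    (is_deriveM_fun (is_derive_cst c z 1) shift_id)) _.
  by rewrite add0r mulr0 addr0 [cst c z]/cst mulr1.
under eq_fun do rewrite exprS.
apply: is_derive_eq (is_deriveM_fun affine IH) _.
rewrite subrr mulr0 addr0 /= [k.+1%:R]mulrS.
by case: k {IH} => [|k] /=; rewrite ?expr0 ?exprS; ring.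
Qed.

Lemma is_derive_sum_fun n (f : 'I_n -> C -> C) (df : 'I_n -> C) (z : C) :
  (forall k, is_derive z (1 : C) (f k) (df k)) ->
  is_derive z (1 : C) (fun x => \sum_(k < n) f k x) (\sum_(k < n) df k).
Proof.
move=> /is_derive_sum; congr is_derive.
by apply/funext => x; rewrite fct_sumE.
Qed.

(* Along the real and the imaginary directions, z^* = w + c (z - z0) with c = 1
   and c = -1; comparing the two derivatives isolates the derivative in z^*. *)
Lemma conj_poly_deriv (p : C -> {poly C}) (z0 : C) d :
  (forall z, (size (p z) <= d)%N) ->
  (forall k, derivable (fun z => (p z)`_k) z0 (1 : C)) ->
  (\forall z \near z0, (p z).[z^*%C] = 0) -> (p z0)^`().[z0^*%C] = 0.
Proof.
move=> sp dp p0; set w := z0^*%C.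
(* [A] collects the derivatives of the coefficients, while [B] is the derivative of the polynomial
   [p z0] at [w]. *)
pose A := \sum_(k < d) w ^+ k * 'D_1 (fun z => (p z)`_k) z0.
pose B := \sum_(k < d) (p z0)`_k * (k%:R * w ^+ k.-1).
have dS c : is_derive z0 (1 : C) (fun z => (p z).[w + c * (z - z0)]) (B * c + A).
  rewrite (_ : (fun z => _) =
    fun z => \sum_(k < d) (p z)`_k * (w + c * (z - z0)) ^+ k).
    rewrite mulr_suml -big_split /=; apply: is_derive_sum_fun => k.
    have dk := is_derive_affineX w c z0 k.
    apply: is_derive_eq (is_deriveM_fun (derivableP (dp k)) dk) _.
    by rewrite subrr mulr0 addr0 mulrA.
  by apply/funext => z; rewrite (horner_coef_wide _ (sp z)).
have AB c u : `|u| = 1 -> (forall r : R, (r%:C * u)^*%C = c * (r%:C * u)) ->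
    B * c + A = 0.
  move=> u1 cu; apply: derive_line_eq0 u1 (dS c) _.
  apply: filterS p0 => z pz [r zE]; rewrite -pz; congr horner.
  by rewrite zE [RHS]rmorphD /= cu addrAC subrr add0r.
have AB1 : B * 1 + A = 0.
  apply: (AB 1 1); rewrite ?normr1 // => r.
  by rewrite mulr1 conjc_real mul1r.
have AB2 : B * (-1) + A = 0.
  apply: (AB (-1) 'i%C); first by rewrite normc_def /= expr0n expr1n add0r sqrtr1.
  move=> r; apply/eqP; rewrite eq_complex /=.
  by apply/andP; split; apply/eqP; ring.
have -> : (p z0)^`().[w] = B.
  rewrite (@horner_coef_wide _ d); last first.
    by apply: leq_trans (size_poly _ _) _; apply: leq_trans (leq_pred _) (sp z0).
  (* For [d = 0] both sums are empty. Otherwise the first term of [B] and the last term of the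
     derivative vanish, and the indices match after a shift by one. *)
  case: d sp @A @B dS AB AB1 AB2 => [|d] sp A B _ _ _ _.
    by rewrite /B !big_ord0.
  rewrite big_ord_recr [B]big_ord_recl /= mul0r mulr0 add0r.
  rewrite coef_deriv nth_default // mul0rn mul0r addr0.
  apply: eq_bigr => k _.
  by rewrite coef_deriv /bump leq0n add1n add0n -[_ *+ k.+1]mulr_natr mulrA.
apply/eqP; have /eqP : 2 * B = 0.
  by rewrite -[RHS](subrr 0) -{1}AB1 -AB2; ring.
by rewrite mulf_eq0 pnatr_eq0.
Qed.

(** Induction on the degree bound: the derivative in the polynomial variable satisfies the same
    hypotheses with a smaller bound, hence is zero. Then each [p z] is a constant, and its value is
    0 by hypothesis. *)
Lemma conj_poly_eq0 (W : set C) (p : C -> {poly C}) d : open W ->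
  (forall z, (size (p z) <= d)%N) ->
  (forall k z, W z -> derivable (fun z => (p z)`_k) z (1 : C)) ->
  (forall z, W z -> (p z).[z^*%C] = 0) -> forall z, W z -> p z = 0.
Proof.
move=> oW; elim: d p => [|d IH] p sp dp p0 z Wz.
  by apply/eqP; rewrite -size_poly_leq0.
have dp0 z' : W z' -> (p z')^`() = 0.
  apply: (IH (fun z => (p z)^`())) => {z' z Wz}[z|k z Wz|z Wz].
  - by apply: leq_trans (size_poly _ _) _; have := sp z; case: (size _).
  - under eq_fun do rewrite coef_deriv -mulr_natl.
    have := is_deriveM_fun (is_derive_cst (k.+1%:R : C) z 1)
      (derivableP (dp k.+1 z Wz)).
    by case.
  - apply: conj_poly_deriv sp _ _ => [k|]; first exact: dp.
    by apply: filterS (open_nbhs_nbhs (conj oW Wz)) => y /p0.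
have pC : p z = ((p z)`_0)%:P.
  apply/polyP => -[|k]; rewrite coefC //=.
  have /eqP := congr1 (fun q : {poly C} => q`_k) (dp0 z Wz).
  by rewrite coef_deriv coef0 mulrn_eq0 => /eqP.
by rewrite pC; move: (p0 z Wz); rewrite pC hornerC coefC => /= ->.
Qed.

Lemma pf_derivable D (F : (nat -> C) -> C) (env : C -> nat -> C) (z : C) :
  pf D F -> (forall i, D i -> derivable (fun x => env x i) z (1 : C)) ->
  derivable (fun x => F (env x)) z (1 : C).
Proof.
move=> pfF denv; elim: pfF => [c|l [i Di ->]|f g _ df _ dg|f g _ df _ dg].
- exact: derivable_cst.
- exact: denv.
- exact: derivableD.
- by apply: ex_derive; apply: is_deriveM_fun; apply: derivableP.
Qed.

End Holomorphic.

(** * Elimination of the conjugate variables, one at a time *)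

Section Elimination.
Variables (R : realType) (n : nat).
Local Notation C := R[i].
Variables (O : set (nat -> C)) (f : (nat -> C) -> C).
Hypothesis O_open : forall a k, (k < n)%N -> O a ->
  open [set z : C | O (upd a k z)].
Hypothesis f_derivable : forall a k, (k < n)%N -> O a ->
  derivable (fun z : C => f (upd a k z)) (a k) (1 : C).

Let conj_env a := complex_env n a (fun j => (a j)^*%C) (f a) 0.

(** In the expansion in powers of the conjugate variable [n + k], every coefficient vanishes on [O],
    and one that is not identically zero becomes the new relation. *)
Lemma conj_elim (G : (nat -> C) -> C) : pf `I_(n + n).+1 G ->
  (exists e, G e != 0) -> (forall a, O a -> G (conj_env a) = 0) ->
  exists H, [/\ pf [set i | (i <= n + n)%N /\ ~ (n <= i < n + n)%N] H,
    exists e, H e != 0 & forall a, O a -> H (conj_env a) = 0].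
Proof.
move=> pfG nzG G0.
suff elim k : (k <= n)%N ->
    exists H, [/\ pf [set i | (i <= n + n)%N /\ ~ (n <= i < n + k)%N] H,
    exists e, H e != 0 & forall a, O a -> H (conj_env a) = 0] by exact: elim.
elim: k => [_|k IH kn].
  exists G; split=> //; apply: pf_sub pfG => i /=; lia.
have [F [pfF nzF F0]] := IH (ltnW kn).
have [d [P [sP cP FP [k0 [e Pe]]]]] := pf_split_neq0 (n + k)%N 0 pfF nzF.
exists (fun e => (P e)`_k0); split; [| by exists e |].
  by apply: pf_sub (cP k0) => i /= [] + /eqP; lia.
move=> a Oa.
(* Only the variable [k] moves, while all conjugate slots keep their values at [a]. Slot [n + k]
   does not occur in the coefficients, so freezing it changes nothing in them and makes them
   holomorphic in [z]. *)
pose env z := complex_env n (upd a k z) (fun j => (a j)^*%C) (f (upd a k z)) 0.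
have upd_id : upd a k (a k) = a.
  by apply/funext => i; rewrite /upd; case: eqP => [->|].
have upd_upd z y : upd (upd a k z) k y = upd a k y.
  by apply/funext => i; rewrite /upd; case: eqP.
suff : P (env (a k)) = 0 by rewrite /env upd_id => ->; rewrite coef0.
apply: (conj_poly_eq0 (W := [set z | O (upd a k z)]) (p := P \o env) (d := d)).
- exact: O_open.
- by move=> z; exact: sP.
- move=> m z Oz; apply: (pf_derivable (cP m)) => i _.
  rewrite /env /complex_env; case: ltnP => [ni|ni].
    by rewrite /upd; case: eqP => _; [exact: derivable_id | exact: derivable_cst].
  case: ltnP => nni; first exact: derivable_cst.
  case: eqP => _; last exact: derivable_cst.
  have upd_k : upd a k z k = z by rewrite /upd eqxx.
  have := f_derivable kn Oz; rewrite upd_k.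
  by under eq_fun do rewrite upd_upd.
- move=> z Oz; rewrite -(F0 _ Oz) FP subr0.
  have -> : conj_env (upd a k z) (n + k)%N = z^*%C.
    rewrite /conj_env /complex_env ifF; last lia.
    by rewrite ltn_add2l kn addKn /upd eqxx.
  congr _.[_]; apply/polyP => m; apply: (pf_local (cP m)) => i.
  rewrite inE => -[_ /= /eqP ik].
  rewrite /env /conj_env /complex_env; case: ltnP => // ni; case: ltnP => // nni.
  by rewrite /upd ifF //; lia.
- by rewrite /= upd_id.
Qed.

End Elimination.

(** Once the conjugate variables are gone, only the coordinates on [M] and [t] occur, so [H]
    descends to the product space; [w] and [s] are arbitrary since [H] does not see them. *)
Lemma nash_polynomial (R : realType) (M : vectType R[i]) (n := \dim {:M})
    (H : (nat -> R[i]) -> R[i]) :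
  pf [set i | (i <= n + n)%N /\ ~ (n <= i < n + n)%N] H -> (exists e, H e != 0) ->
  exists P : M * R[i] -> R[i],
  [/\ complex_poly_fun P, exists z, P z != 0 &
    forall a w t s, P (vec_of M a, t) = H (complex_env n a w t s)].
Proof.
move=> pfH [e He].
exists (fun z => H (complex_env n (coords z.1) (fun=> 0) z.2 0)).
have HE a w t s : H (complex_env n (coords (vec_of M a)) (fun=> 0) t 0)
    = H (complex_env n a w t s).
  apply: (pf_local pfH) => i; rewrite inE /= /complex_env => -[i2n ni].
  case: ltnP => [iltn|nlei].
    by rewrite /coords insubT coord_vec_of.
  by do 2!(rewrite ifF; last lia; rewrite ifT; last lia).
split.
- apply: (poly_fun_comp _ pfH) => l [i _ ->]; rewrite /comp /complex_env.
  case: ltnP => [iltn|nlei].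
    rewrite /coords insubT; apply: PolyLin => c u v /=.
    by rewrite linearP.
  case: ltnP => nni; first exact: PolyCst.
  by case: eqP => _; [apply: PolyLin => c u v | exact: PolyCst].
- exists (vec_of M e, e (n + n)%N).
  rewrite /= (HE _ (fun j => e (n + j)%N) _ 0) (pf_local (e' := e) pfH) // => i.
  rewrite inE /complex_env /= => -[i2n ni].
  case: ltnP => // nlei; case: ltnP => nni; first by rewrite subnKC.
  by case: eqP => [->|] //; lia.
- by move=> a w t s; exact: HE.
Qed.

(** * Holomorphic maps in coordinates *)

Section HolomorphicCoordinates.
Variable R : realType.
Local Notation C := R[i].
Implicit Types (M N : vectType C).

Lemma row_upd n (a : nat -> C) (k : 'I_n) :
  (fun z => \row_(j < n) upd a k z j) =
  (fun z : C => z *: delta_mx 0 k + \row_j upd a k 0 j) :> (C -> 'rV[C]_n).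
Proof.
apply/funext => z; apply/rowP => j; rewrite !mxE /upd eqxx /=.
by rewrite val_eqE; case: eqP => _; rewrite ?mulr1 ?addr0 // mulr0 add0r.
Qed.

Lemma differentiable_row_upd n (a : nat -> C) (k : 'I_n) (z : C) :
  differentiable (fun z => \row_(j < n) upd a k z j : 'rV[C]_n) z.
Proof.
rewrite row_upd; apply: differentiableD; last exact: differentiable_cst.
exact: differentiableZl.
Qed.

Lemma open_vect_upd M (Omega : set M) (a : nat -> C) k : (k < \dim {:M})%N ->
  open_vect Omega -> open [set z : C | Omega (vec_of M (upd a k z))].
Proof.
move=> kn oOmega.
apply: (@open_comp _ _ (fun z => \row_(j < \dim {:M}) upd a k z j)) oOmega.
move=> z _; apply: differentiable_continuous.
exact: (differentiable_row_upd a (Ordinal kn)).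
Qed.

Lemma coord_holomorphic M N (Omega : set M) (phi : M -> N) (x : M) c :
  holomorphic Omega phi -> Omega x ->
  differentiable (fun u : 'rV[C]_(\dim {:M}) =>
    coord (vbasis {:N}) c (phi (vecof (vbasis {:M}) u))) (rVof (vbasis {:M}) x).
Proof.
move=> hphi Ox; under eq_fun do rewrite coord_rVof.
exact: differentiable_comp (hphi x Ox) (differentiable_coord _ _ _).
Qed.

Lemma holomorphic_coord M N (Omega : set M) (phi : M -> N) c :
  holomorphic Omega phi ->
  holomorphic Omega (fun x => coord (vbasis {:N}) c (phi x)).
Proof.
move=> hphi x Ox.
pose h t := rVof (vbasis {:C}) t.
(* [holomorphic] reads values in [C] in the basis [vbasis {:C}] too; this amounts to scaling the
   fixed row [h 1]. *)
have hE t : h t = t *: h 1.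
  by rewrite /h -linearZ; congr rVof; rewrite [_ *: _]mulr1.
under eq_fun do rewrite -/(h _) hE.
by apply: differentiableZl; exact: (coord_holomorphic c hphi Ox).
Qed.

Lemma coord_derivable_upd M N (Omega : set M) (phi : M -> N) c a k :
  (k < \dim {:M})%N -> holomorphic Omega phi -> Omega (vec_of M a) ->
  derivable (fun z : C => coord (vbasis {:N}) c (phi (vec_of M (upd a k z))))
    (a k) (1 : C).
Proof.
move=> kn hphi Oa; apply: diff_derivable.
apply: (@differentiable_comp _ _ _ _ (fun z => \row_(j < \dim {:M}) upd a k z j)
  (fun u => coord (vbasis {:N}) c (phi (vecof (vbasis {:M}) u)))).
  exact: (differentiable_row_upd a (Ordinal kn)).
suff <- : rVof (vbasis {:M}) (vec_of M a) = \row_j upd a k (a k) j.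
  exact: (coord_holomorphic c hphi Oa).
apply/rowP => j; rewrite !mxE coord_vec_of /upd.
by case: eqP => // ->.
Qed.

End HolomorphicCoordinates.

Theorem proposition4 (R : realType) (M N : vectType R[i])
    (Omega : set M) (phi : M -> N)
    (Omega_open : open_vect Omega)
    (Omega_semialg : semialgebraic Omega)
    (phi_holo_semialg : holomorphic_semialgebraic Omega phi) :
  nash_mapping Omega phi.
Proof.
have [hphi sphi] := phi_holo_semialg; split=> //.
exists (vbasis {:N}); split; first exact: vbasisP.
move=> c; split; first exact: holomorphic_coord.
pose f a := coord (vbasis {:N}) c (phi (vec_of M a)).
pose O := [set a | Omega (vec_of M a)].
have [F [pfF nzF F0]] := semialgebraic_component c sphi.
have [G [pfG nzG G0]] := real_relation_complex (O := O) (f := f) pfF nzF F0.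
have O_open a k : (k < \dim {:M})%N -> O a -> open [set z | O (upd a k z)].
  by move=> kn _; exact: open_vect_upd.
have f_derivable a k : (k < \dim {:M})%N -> O a ->
    derivable (fun z => f (upd a k z)) (a k) 1.
  by move=> kn Oa; exact: coord_derivable_upd Oa.
have [H [pfH nzH H0]] := conj_elim O_open f_derivable pfG nzG G0.
have [P [pfP nzP PH]] := nash_polynomial pfH nzH.
(* The same [P] and the same neighbourhood [Omega] serve every [x0]. *)
move=> x0 Ox0; exists Omega, P; split; split=> // x Ox.
rewrite -{1}(coordsK x) (PH _ (fun j => (coords x j)^*%C) _ 0).
by have := H0 (coords x); rewrite /O /f /= coordsK; apply.
Qed.
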